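(* Let $d\ge1$ and let $\alpha=(\alpha_1,\dots,\alpha_d)\in\mathbb{R}^d$ be such that $1,\alpha_1,\dots,\alpha_d$ are linearly independent over $\mathbb{Q}$ and span (as a $\mathbb{Q}$-vector space) a real algebraic number field of degree $d+1$ over $\mathbb{Q}$ (e.g. $\alpha=(p^{1/(d+1)},\dots,p^{d/(d+1)})$ for a prime $p$). Define $N_1=1$ and, for $i\ge2$, let $N_i$ be the smallest integer $N>N_{i-1}$ with $\langle N\alpha\rangle<\langle N_{i-1}\alpha\rangle$; let $z^{(i)}=(z^{(i)}_1,\dots,z^{(i)}_d)$ where $z^{(i)}_j$ is the nearest integer to $N_i\alpha_j$. Then the family of rank-1 lattice point sets $(P_{N_i,z^{(i)}})_{i\ge2}$ is a quasi-uniform family of point sets over $[0,1]^d$; in particular there is a constant $C$, independent of $i$, with $\rho(P_{N_i,z^{(i)}})\le C$ for all $i\ge 2$.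
   Context: For $x\in\mathbb{R}^d$, $\langle x\rangle=\max_{1\le j\le d}\min_{k\in\mathbb{Z}}|x_j-k|$. For $N\in\mathbb{N}$ and $z\in\mathbb{Z}^d$ with $\gcd(N,z_1,\dots,z_d)=1$, the rank-1 lattice point set is $P_{N,z}=\{(\{nz_1/N\},\dots,\{nz_d/N\}) : n=0,1,\dots,N-1\}\subset[0,1)^d$, where $\{x\}=x-\lfloor x\rfloor$; it equals $\Lambda\cap[0,1)^d$ for the lattice $\Lambda=\frac1N z\mathbb{Z}+\mathbb{Z}^d$. For a finite point set $P\subset[0,1]^d$ with at least two points: covering radius $h(P)=\sup_{x\in[0,1]^d}\min_{y\in P}\|x-y\|_2$, separation radius $q(P)=\frac12\min_{x,y\in P,\,x\ne y}\|x-y\|_2$, mesh ratio $\rho(P)=h(P)/q(P)$. A family $(P_{N_i})_{i}$ of point sets in $[0,1]^d$ with $N_i=|P_{N_i}|$ is a quasi-uniform family if there is a constant $c>1$ with $N_i<N_{i+1}\le cN_i$ for all $i$, and a constant $C_d$ independent of $i$ with $\rho(P_{N_i})\le C_d$ for all $i$. *)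

(* Defs.v *)
From HB Require Import structures.
From mathcomp Require Import all_boot all_order all_algebra.
From mathcomp Require Import all_classical all_reals.
Set Implicit Arguments. Unset Strict Implicit. Unset Printing Implicit Defensive.
Import Order.TTheory GRing.Theory Num.Theory.
Local Open Scope classical_set_scope.
Local Open Scope ring_scope.

Section Defs.
Variable R : realType.
Variable d : nat.

Definition pt := 'I_d -> R.

Definition dist_int (t : R) : R := inf [set `|t - k%:~R| | k in [set: int]].

Definition torus_norm (x : pt) : R := \big[Num.max/0]_(j < d) dist_int (x j).

Definition frac (t : R) : R := t - (Num.floor t)%:~R.

Definition edist (x y : pt) : R := Num.sqrt (\sum_(j < d) (x j - y j) ^+ 2).

Definition cube : set pt := [set x | forall j, 0 <= x j <= 1].

Definition rank1_lattice (N : nat) (z : 'I_d -> int) : set pt :=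
  [set x | exists2 n : nat, (n < N)%N &
     x = (fun j => frac ((n%:R * (z j)%:~R) / N%:R))].

Definition cov_radius (P : set pt) : R :=
  sup [set inf [set edist x y | y in P] | x in cube].

Definition sep_radius (P : set pt) : R :=
  inf [set edist xy.1 xy.2 | xy in [set xy : pt * pt | P xy.1 /\ P xy.2 /\ xy.1 <> xy.2]] / 2.

Definition mesh_ratio (P : set pt) : R := cov_radius P / sep_radius P.

Definition Qspan (alpha : 'I_d -> R) : set R :=
  [set x | exists (c0 : rat) (c : 'I_d -> rat),
     x = ratr c0 + \sum_(j < d) ratr (c j) * alpha j].

Definition Q_lin_indep (alpha : 'I_d -> R) : Prop :=
  forall (c0 : rat) (c : 'I_d -> rat),
    ratr c0 + \sum_(j < d) ratr (c j) * alpha j = 0 ->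
    c0 = 0 /\ forall j, c j = 0.

End Defs.

Definition is_subfield (R : realType) (S : set R) : Prop :=
  S 0 /\ S 1 /\ (forall x y, S x -> S y -> S (x + y)) /\
  (forall x, S x -> S (- x)) /\ (forall x y, S x -> S y -> S (x * y)) /\
  (forall x, S x -> x != 0 -> S x^-1).

(* Main.v *)
(** The vector [alpha] is badly approximable: if [|q alpha_j - p_j| <= e] for all
    [j], then [q e^d] is bounded below.  Indeed multiplication by
    [c_0 + sum_j c_j alpha_j] on the basis [1, alpha_1, ..., alpha_d] is, up to a
    fixed denominator, an integer matrix with nonzero determinant, which bounds
    the linear form from below by [max |c|^-d]; choosing by pigeonhole a small
    integral [c] with [sum_j c_j p_j = 0] modulo [q] transfers this to
    simultaneous approximation.

    Put [e = <N_i alpha>], so that [N_i e^d] is bounded below.  As no [n < N_i]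
    approximates better than [N_i], Dirichlet's theorem gives
    [N_(i+1) <= const e^-d <= const N_i], and two points of the lattice are at
    sup-distance at least [e / 2], because
    [n z / N_i - p = (n alpha - p) - (n / N_i) (N_i alpha - z)] and one may take
    [n <= N_i / 2].  A point at distance [D] from the lattice yields, along a
    segment from the origin, about [D / e] points at increasing distances from
    the lattice; their translates by the [N_i] lattice points of the torus are
    [e / 2]-separated, so pigeonhole gives [(D / e) N_i <= const e^-d], that is
    [D <= const e]. *)
Require Import Defs.
From HB Require Import structures.
From mathcomp Require Import all_boot all_order all_algebra.
From mathcomp Require Import all_classical all_reals.
From mathcomp Require Import perm ring lra zify.
Set Implicit Arguments. Unset Strict Implicit. Unset Printing Implicit Defensive.
Import Order.TTheory GRing.Theory Num.Theory.
Local Open Scope classical_set_scope.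
Local Open Scope ring_scope.

(** * Integer matrices and the norm argument *)

Lemma normr_det_le (R : numDomainType) (n : nat) (A : 'M[R]_n) (T : R) :
  (forall i j, `|A i j| <= T) -> `|\det A| <= n`!%:R * T ^+ n.
Proof.
move=> AT; apply: le_trans (ler_norm_sum _ _ _) _.
have -> : n`!%:R * T ^+ n = \sum_(s : 'S_n) T ^+ n.
  by rewrite sumr_const card_Sn mulr_natl.
apply: ler_sum => s _; rewrite normrM normrX normrN1 expr1n mul1r normr_prod.
have -> : T ^+ n = \prod_(i < n) T by rewrite prodr_const card_ord.
by apply: ler_prod => i _; rewrite normr_ge0 AT.
Qed.

Lemma common_denominator (I : finType) (c : I -> rat) :
  exists D : int, D != 0 /\
    exists b : I -> int, forall i, D%:~R * c i = (b i)%:~R.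
Proof.
exists (\prod_i denq (c i)); split.
  by apply/prodf_neq0 => i _; exact: denq_neq0.
exists (fun i => numq (c i) * \prod_(j | j != i) denq (c j)) => i.
rewrite (bigD1 i) //= !intrM numqE.
by rewrite mulrC mulrA.
Qed.

(** [B k] acts on [v] as multiplication by [D v_k], so [M = sum_k c_k B_k] has [v] as eigenvector
    with eigenvalue [D xi], where [xi = c v]. Row 0 of [adj M] applied to this relation writes the
    nonzero integer [det M] as [D xi] times a combination of minors of size [n], which are of order
    [b^n]. *)
Lemma norm_form_bound (R : realFieldType) (n : nat) (v : 'cV[R]_n.+1) (D : int)
    (B : 'I_n.+1 -> 'M[int]_n.+1) :
  v ord0 0 = 1 ->
  (forall u : 'rV[int]_n.+1, map_mx intr u *m v = 0 -> u = 0) ->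
  D != 0 ->
  (forall k, map_mx intr (B k) *m v = (D%:~R * v k 0) *: v) ->
  exists kappa : R, 0 < kappa /\
    forall (c : 'rV[int]_n.+1) (b : R), c != 0 ->
      (forall k, `|c 0 k|%:~R <= b) ->
      kappa <= `|(map_mx intr c *m v) 0 0| * b ^+ n.
Proof.
move=> v0 vfree D0 vB.
pose S : R := \sum_(t : 'I_n.+1 * ('I_n.+1 * 'I_n.+1)) `|B t.1 t.2.1 t.2.2|%:~R.
have S0 : 0 <= S by apply: sumr_ge0 => t _; rewrite ler0z.
pose V : R := \sum_l `|v l 0|.
have V0 : 0 <= V by apply: sumr_ge0.
pose W : R := `|D|%:~R * n`!%:R * S ^+ n * V.
have W0 : 0 <= W by rewrite !mulr_ge0 ?exprn_ge0 ?ler0z.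
(* Only [0 <= W] is known; adding 1 makes the inverse positive. *)
exists (W + 1)^-1; split; first by rewrite invr_gt0; lra.
move=> c b c0 cb.
set xi := (map_mx intr c *m v) 0 0.
have xiE : map_mx intr c *m v = xi%:M by exact: mx11_scalar.
have xi0 : xi != 0.
  apply: contraNneq c0 => xi0; apply/eqP/vfree.
  by rewrite xiE xi0 raddf0.
have b0 : 0 <= b by apply: le_trans (cb 0); rewrite ler0z.
pose M : 'M[int]_n.+1 := \sum_k c 0 k *: B k.
pose MR : 'M[R]_n.+1 := map_mx intr M.
have MRv : MR *m v = (D%:~R * xi) *: v.
  rewrite /MR /M map_mx_sum mulmx_suml.
  rewrite (eq_bigr (fun k => ((c 0 k)%:~R * (D%:~R * v k 0)) *: v)); last first.
    by move=> k _; rewrite map_mxZ -scalemxAl vB scalerA.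
  rewrite -scaler_suml; congr (_ *: _).
  rewrite /xi mxE mulr_sumr; apply: eq_bigr => k _.
  by rewrite mxE; ring.
have detM : \det M != 0.
  (* A left null vector [u] of [M] gives [D xi (u v) = 0], so [u v = 0] and [u = 0] by freeness. *)
  apply/negP => /det0P [u u0 uM].
  move/negP: u0; apply; apply/eqP/vfree.
  have := congr1 (mulmx (map_mx intr u)) MRv.
  rewrite mulmxA -map_mxM uM /= map_mx0 mul0mx -scalemxAr => /esym/eqP.
  by rewrite scaler_eq0 mulf_eq0 intr_eq0 (negbTE D0) (negbTE xi0) => /eqP.
have det1 : 1 <= `|\det MR|.
  rewrite det_map_mx -intr_norm -[1]/(1%:~R) ler_int.
  by move: detM; lia.
have entry l i j : `|row' l (col' 0 MR) i j| <= b * S.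
  rewrite !mxE /M summxE rmorph_sum /=.
  apply: le_trans (ler_norm_sum _ _ _) _.
  rewrite /S mulr_sumr -(pair_bigA_idem _ (fun k t => b * `|B k t.1 t.2|%:~R)) /= ?addr0 //.
  apply: ler_sum => k _.
  rewrite (bigD1 (lift l i, lift 0 j)) //=.
  rewrite mxE intrM normrM -!intr_norm.
  apply: le_trans (ler_wpM2r _ (cb k)) _; first by rewrite ler0z.
  by rewrite lerDl sumr_ge0 // => t _; rewrite mulr_ge0 ?ler0z.
have adjE : \det MR = D%:~R * xi * \sum_l (\adj MR) 0 l * v l 0.
  have := congr1 (mulmx (\adj MR)) MRv.
  rewrite mulmxA mul_adj_mx -scalemxAr mul_scalar_mx => /matrixP /(_ 0 0).
  by rewrite !mxE v0 mulr1.
have sumle : `|\sum_l (\adj MR) 0 l * v l 0| <= n`!%:R * (b * S) ^+ n * V.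
  apply: le_trans (ler_norm_sum _ _ _) _.
  rewrite /V mulr_sumr; apply: ler_sum => l _.
  rewrite normrM ler_wpM2r // mxE /cofactor normrM normrX normrN1 expr1n mul1r.
  exact: normr_det_le.
have le1 : 1 <= `|xi| * b ^+ n * W.
  apply: le_trans det1 _.
  rewrite adjE !normrM -intr_norm.
  have -> : `|xi| * b ^+ n * W = `|D|%:~R * `|xi| * (n`!%:R * (b * S) ^+ n * V).
    by rewrite /W exprMn; ring.
  by rewrite ler_wpM2l // mulr_ge0 ?ler0z.
have X0 : 0 <= `|xi| * b ^+ n by rewrite mulr_ge0 ?exprn_ge0.
rewrite -[leLHS]mul1r ler_pdivrMr; last by lra.
by rewrite mulrDr mulr1; lra.
Qed.

(** * Diophantine approximation *)

(** The structure constants of the field in the basis [1, alpha_1, ..., alpha_d], cleared of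
    denominators, are the matrices that [norm_form_bound] requires. *)
Lemma linear_form_bound (R : realType) (d : nat) (alpha : 'I_d -> R) :
  Q_lin_indep alpha ->
  (forall x y, Qspan alpha x -> Qspan alpha y -> Qspan alpha (x * y)) ->
  exists kappa : R, 0 < kappa /\
    forall (c0 : int) (c : 'I_d -> int) (b : R),
      (exists j, c j != 0) ->
      `|c0%:~R| <= b -> (forall j, `|(c j)%:~R| <= b) ->
      kappa <= `|c0%:~R + \sum_(j < d) (c j)%:~R * alpha j| * b ^+ d.
Proof.
move=> indep spanM.
pose ext (T : Type) (x0 : T) (x : 'I_d -> T) (i : 'I_d.+1) :=
  if unlift ord0 i is Some j then x j else x0.
have ext0 T (x0 : T) x : ext T x0 x ord0 = x0 by rewrite /ext unlift_none.
have extl T (x0 : T) x j : ext T x0 x (lift ord0 j) = x j by rewrite /ext liftK.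
pose v : 'cV[R]_d.+1 := \col_i ext R 1 alpha i.
have v0 : v ord0 0 = 1 by rewrite mxE ext0.
have vl j : v (lift ord0 j) 0 = alpha j by rewrite mxE extl.
have spanv i : Qspan alpha (v i 0).
  case: (unliftP ord0 i) => [j ->|->].
    exists 0, (fun l => (l == j)%:R).
    rewrite vl raddf0 add0r (bigD1 j) //= eqxx rmorph1 mul1r big1 ?addr0 //.
    by move=> l /negbTE ->; rewrite raddf0 mul0r.
  exists 1, (fun=> 0); rewrite v0 rmorph1 big1 ?addr0 // => l _.
  by rewrite raddf0 mul0r.
have prodv (t : 'I_d.+1 * 'I_d.+1) : exists a : 'I_d.+1 -> rat,
    v t.1 0 * v t.2 0 = \sum_l ratr (a l) * v l 0.
  have [a0 [a aE]] := spanM _ _ (spanv t.1) (spanv t.2).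
  exists (ext rat a0 a); rewrite aE big_ord_recl ext0 v0 mulr1; congr (_ + _).
  by apply: eq_bigr => j _; rewrite extl vl.
have [a aE] := choice prodv.
have [D [D0 [b bE]]] :=
  common_denominator (fun t : ('I_d.+1 * 'I_d.+1) * 'I_d.+1 => a t.1 t.2).
pose B (k : 'I_d.+1) : 'M[int]_d.+1 := \matrix_(i, l) b ((k, i), l).
have BE k : map_mx intr (B k) *m v = (D%:~R * v k 0) *: v.
  apply/matrixP => i j; rewrite {j}ord1 !mxE -!mulrA.
  have := aE (k, i); rewrite !mxE /= => ->; rewrite mulr_sumr.
  apply: eq_bigr => l _; rewrite !mxE.
  by rewrite mulrA -[(b _)%:~R]ratr_int -bE rmorphM /= ratr_int.
have formE (u : 'rV[int]_d.+1) : (map_mx intr u *m v) 0 0 =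
    (u 0 ord0)%:~R + \sum_(j < d) (u 0 (lift ord0 j))%:~R * alpha j.
  rewrite mxE big_ord_recl v0 !mxE mulr1; congr (_ + _).
  by apply: eq_bigr => j _; rewrite vl !mxE.
have vfree (u : 'rV[int]_d.+1) : map_mx intr u *m v = 0 -> u = 0.
  move=> /matrixP/(_ 0 0); rewrite formE mxE => u0.
  have [] := indep (u 0 ord0)%:~R (fun j => (u 0 (lift ord0 j))%:~R).
    rewrite ratr_int -[RHS]u0; congr (_ + _).
    by apply: eq_bigr => j _; rewrite ratr_int.
  move=> /eqP; rewrite intr_eq0 => /eqP h0 hl; apply/matrixP => i k.
  rewrite {i}ord1 mxE; case: (unliftP ord0 k) => [j ->|->] //.
  by apply/eqP; rewrite -(intr_eq0 rat) hl.
have [kappa [kappa0 kP]] := norm_form_bound v0 vfree D0 BE.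
exists kappa; split=> // c0 c bd [j cj] c0b cb.
have := kP (\row_i ext int c0 c i) bd; rewrite formE !mxE ext0.
under eq_bigr do rewrite mxE extl.
apply.
  apply: contraNneq cj => /matrixP/(_ 0 (lift ord0 j)).
  by rewrite !mxE extl => ->.
move=> k; rewrite mxE intr_norm.
by case: (unliftP ord0 k) => [l ->|->]; rewrite ?extl ?ext0.
Qed.

(** Both pigeonhole arguments send an integer to its residue class as an ordinal; the outer
    reduction on naturals only supplies the bound that the ordinal type demands. *)
Lemma absz_modz_inj (q : nat) (s s' : int) : (0 < q)%N ->
  (`|(s %% q%:Z)%Z| %% q = `|(s' %% q%:Z)%Z| %% q)%N ->
  exists t : int, s - s' = q%:Z * t.
Proof.
move=> q0; have qZ : q%:Z != 0 by lia.
have lt h : (`|(h %% q%:Z)%Z| < q)%N.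
  by have := ltz_mod h qZ; have := modz_ge0 h qZ; lia.
rewrite !modn_small // => E; exists ((s %/ q%:Z)%Z - (s' %/ q%:Z)%Z).
have rr : (s %% q%:Z)%Z = (s' %% q%:Z)%Z.
  by have := modz_ge0 s qZ; have := modz_ge0 s' qZ; lia.
by rewrite {1}(divz_eq s q%:Z) {1}(divz_eq s' q%:Z) rr; ring.
Qed.

Lemma ord_dist_le (n : nat) (a b : 'I_n.+1) : `|a%:Z - b%:Z| <= n%:Z.
Proof. by have := ltn_ord a; have := ltn_ord b; lia. Qed.

Lemma simultaneous_approx_bound (R : realType) (d : nat) (alpha : 'I_d -> R) :
  (0 < d)%N ->
  Q_lin_indep alpha ->
  (forall x y, Qspan alpha x -> Qspan alpha y -> Qspan alpha (x * y)) ->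
  exists kappa : R, 0 < kappa /\
    forall (q : nat) (p : 'I_d -> int) (e : R), (0 < q)%N ->
      (forall j, `|q%:R * alpha j - (p j)%:~R| <= e) ->
      kappa <= q%:R * e ^+ d.
Proof.
move=> d0 indep spanM.
have [kappa [kappa0 kP]] := linear_form_bound indep spanM.
(* [X Y] will bound all coefficients of the form [L] below: [|t| <= |L| + sum_j |c_j alpha_j| <= X
   (d + sum_j |alpha_j|)]. *)
pose Y : R := d%:R + \sum_j `|alpha j|.
have A0 : 0 <= \sum_j `|alpha j| by apply: sumr_ge0.
have dR : 1 <= d%:R :> R by rewrite ler1n.
have Y1 : 1 <= Y by rewrite /Y; lra.
have Yd0 : 0 < d%:R * Y ^+ d by rewrite mulr_gt0 ?exprn_gt0 //; lra.
pose k1 := (kappa / (d%:R * Y ^+ d)) ^+ d.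
have k10 : 0 < k1 by rewrite exprn_gt0 // divr_gt0.
exists (Num.min 1 k1); split; first by rewrite lt_min ltr01.
move=> q p e q0 qe.
have qR : 1 <= q%:R :> R by rewrite ler1n.
(* If [1 <= e] then [1 <= q e^d]; the other case uses [e < 1] to bound [L]. *)
have [e1|e1] := leP 1 e.
  apply: le_trans (_ : 1 <= _); first by rewrite ge_min lexx.
  by rewrite -[leLHS]mulr1 ler_pM // exprn_ege1.
suff : k1 <= q%:R * e ^+ d by apply: le_trans; rewrite ge_min lexx orbT.
have e0 : 0 <= e by apply: le_trans (qe (Ordinal d0)).
(* [X] is the integer part of the [d]-th root of [q]: the box [{0..X}^d] has more than [q] points,
   while [X^d <= q]. *)
have [X [X1 Xq qX]] : exists X, [/\ (0 < X)%N, (X ^ d <= q)%N & (q < X.+1 ^ d)%N].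
  have ex : exists X, (X ^ d <= q)%N by exists 0%N; rewrite exp0n.
  have bd X : (X ^ d <= q -> X <= q)%N.
    by apply: leq_trans; rewrite -[leqLHS]expn1; case: X => // X; rewrite leq_pexp2l.
  case: (ex_maxnP ex bd) => X Xq Xmax; exists X; split=> //.
    by apply: Xmax; rewrite exp1n.
  by rewrite ltnNge; apply/negP => /Xmax; rewrite ltnn.
have [f [g [fg [t tE]]]] : exists f g : {ffun 'I_d -> 'I_X.+1}, f != g /\
    exists t : int, \sum_j ((f j)%:Z - (g j)%:Z) * p j = q%:Z * t.
  pose F (f : {ffun 'I_d -> 'I_X.+1}) : 'I_q :=
    Ordinal (ltn_pmod `|((\sum_j (f j)%:Z * p j)%R %% q%:Z)%Z|%N q0).
  have : ~~ injectiveb F.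
    apply/negP => /injectiveP /leq_card.
    by rewrite card_ffun !card_ord leqNgt qX.
  move=> /injectivePn [f [g fg /(congr1 val) /=]].
  move=> /(absz_modz_inj q0) [t tE]; exists f, g; split=> //; exists t.
  by rewrite -tE -sumrB; apply: eq_bigr => j _; rewrite mulrBl.
pose c j : int := (f j)%:Z - (g j)%:Z.
have cX j : `|(c j)%:~R| <= X%:R :> R.
  by rewrite -intr_norm pmulrn ler_int ord_dist_le.
have [j cj] : exists j, c j != 0.
  apply/existsP; apply: contraNT fg => /existsPn fg.
  apply/eqP/ffunP => j; apply/val_inj => /=.
  by have := fg j; rewrite negbK subr_eq0 eqz_nat => /eqP.
(* The integer [t] is chosen so that the [p_j] cancel: [q L = sum_j c_j (q alpha_j - p_j)], whence
   [q |L| <= d X e]. *)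
pose L : R := (- t)%:~R + \sum_(j < d) (c j)%:~R * alpha j.
have qL : q%:R * L = \sum_j (c j)%:~R * (q%:R * alpha j - (p j)%:~R).
  under [RHS]eq_bigr do rewrite mulrBr.
  rewrite sumrB.
  have -> : \sum_j (c j)%:~R * (p j)%:~R = q%:R * t%:~R :> R.
    under eq_bigr do rewrite -intrM.
    by rewrite -rmorph_sum /= tE intrM -pmulrn.
  rewrite /L mulrDr intrN mulr_sumr addrC mulrN; congr (_ - _).
  by apply: eq_bigr => i _; rewrite mulrCA.
have X1R : 1 <= X%:R :> R by rewrite ler1n.
have qLe : q%:R * `|L| <= d%:R * (X%:R * e).
  rewrite -[q%:R]ger0_norm // -normrM qL.
  apply: le_trans (ler_norm_sum _ _ _) _.
  have -> : d%:R * (X%:R * e) = \sum_(j < d) X%:R * e.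
    by rewrite sumr_const card_ord mulr_natl.
  by apply: ler_sum => i _; rewrite normrM ler_pM.
have Le : `|L| <= d%:R * X%:R.
  apply: le_trans (_ : q%:R * `|L| <= _).
    by rewrite -[leLHS]mul1r ler_wpM2r.
  by apply: le_trans qLe _; rewrite ler_wpM2l // -[leRHS]mulr1 ler_wpM2l // ltW.
have tb : `|(- t)%:~R| <= X%:R * Y.
  have -> : (- t)%:~R = L - \sum_(j < d) (c j)%:~R * alpha j by rewrite addrK.
  apply: le_trans (ler_normB _ _) _.
  rewrite /Y mulrDr [X%:R * d%:R]mulrC lerD //.
  apply: le_trans (ler_norm_sum _ _ _) _.
  by rewrite mulr_sumr; apply: ler_sum => i _; rewrite normrM ler_wpM2r.
have cb i : `|(c i)%:~R| <= X%:R * Y.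
  by apply: le_trans (cX i) _; rewrite -[leLHS]mulr1 ler_wpM2l.
have kL := kP _ _ _ (ex_intro _ j cj) tb cb.
rewrite -/L in kL.
(* Multiply the lower bound on [L] by [q]; then [X^d <= q] lets [q] cancel. *)
have kXe : kappa <= d%:R * Y ^+ d * (X%:R * e).
  have q0R : 0 < q%:R :> R by apply: lt_le_trans qR.
  rewrite -(ler_pM2l q0R); apply: le_trans (ler_wpM2l (ltW q0R) kL) _.
  rewrite [leLHS]mulrA; apply: le_trans (ler_wpM2r _ qLe) _.
    by rewrite exprn_ge0 // mulr_ge0 // (le_trans ler01).
  rewrite exprMn.
  have -> : d%:R * (X%:R * e) * (X%:R ^+ d * Y ^+ d) =
    X%:R ^+ d * (d%:R * Y ^+ d * (X%:R * e)) by ring.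
  apply: ler_wpM2r; last by rewrite -natrX ler_nat.
  by rewrite mulr_ge0 ?(ltW Yd0) // mulr_ge0.
apply: le_trans (_ : (X%:R * e) ^+ d <= _); last first.
  by rewrite exprMn ler_wpM2r ?exprn_ge0 // -natrX ler_nat.
rewrite /k1 ler_pXn2r ?nnegrE ?mulr_ge0 //; last 2 first.
- by rewrite ltW.
- by rewrite invr_ge0 ltW.
by rewrite ler_pdivrMr // mulrC.
Qed.

(** The values [floor (K f)] modulo [K] sort the points of the torus into [K^d] boxes of side
    [1 / K], and two of the points share a box. *)
Lemma torus_pigeonhole (R : realType) (d K : nat) (I : finType)
    (f : I -> 'I_d -> R) :
  (0 < K)%N -> (K ^ d < #|I|)%N ->
  exists a b : I, a != b /\
    exists p : 'I_d -> int, forall j, `|f a j - f b j - (p j)%:~R| < K%:R^-1.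
Proof.
move=> K0 KI.
have KR : 0 < K%:R :> R by rewrite ltr0n.
pose F (i : I) : {ffun 'I_d -> 'I_K} :=
  [ffun j => Ordinal (ltn_pmod `|(Num.floor (K%:R * f i j) %% K%:Z)%Z|%N K0)].
have : ~~ injectiveb F.
  apply/negP => /injectiveP /leq_card.
  by rewrite card_ffun !card_ord leqNgt KI.
move=> /injectivePn [a [b ab /ffunP FE]]; exists a, b; split=> //.
have mod j : exists t : int,
    Num.floor (K%:R * f a j) - Num.floor (K%:R * f b j) = K%:Z * t.
  by apply: (absz_modz_inj K0); have := congr1 val (FE j); rewrite !ffunE.
have [p pE] := choice mod; exists p => j.
have /andP[sa1 sa2] := floor_itv (K%:R * f a j).
have /andP[sb1 sb2] := floor_itv (K%:R * f b j).
have : (Num.floor (K%:R * f a j))%:~R - (Num.floor (K%:R * f b j))%:~R =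
    K%:R * (p j)%:~R :> R by rewrite -intrB pE intrM -pmulrn.
move: sa1 sa2 sb1 sb2; rewrite !intrD => sa1 sa2 sb1 sb2 ssR.
rewrite -(ltr_pM2l KR) divff ?gt_eqF // -[X in X * `|_|]ger0_norm ?(ltW KR) //.
rewrite -normrM !mulrBr -ssR ltr_norml; apply/andP; split; lra.
Qed.

Lemma dist_int_le (R : realType) (t : R) (k : int) : dist_int t <= `|t - k%:~R|.
Proof.
apply: ge_inf; last by exists k.
by exists 0 => _ [l _ <-].
Qed.

Lemma le_dist_int (R : realType) (t r : R) :
  (forall k : int, r <= `|t - k%:~R|) -> r <= dist_int t.
Proof.
move=> rt; apply: lb_le_inf; first by exists `|t - 0%:~R|, 0.
by move=> _ [k _ <-].
Qed.

Lemma torus_norm_lt (R : realType) (d : nat) (x : 'I_d -> R) (p : 'I_d -> int) (r : R) :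
  0 < r -> (forall j, `|x j - (p j)%:~R| < r) -> torus_norm x < r.
Proof.
move=> r0 xp; apply: bigmax_lt => // j _.
exact: le_lt_trans (dist_int_le _ _) (xp j).
Qed.

Lemma torus_norm_ge0 (R : realType) (d : nat) (x : 'I_d -> R) : 0 <= torus_norm x.
Proof. exact: bigmax_ge_id. Qed.

Lemma torus_norm_le1 (R : realType) (d : nat) (x : 'I_d -> R) : torus_norm x <= 1.
Proof.
apply: bigmax_le => // j _; apply: le_trans (dist_int_le _ (Num.floor (x j))) _.
have /andP[] := floor_itv (x j); rewrite intrD => ? ?.
by rewrite ler_norml; apply/andP; split; lra.
Qed.

Lemma nearest_le_torus_norm (R : realType) (d : nat) (x : 'I_d -> R) (z : 'I_d -> int) j :
  (forall k : int, `|x j - (z j)%:~R| <= `|x j - k%:~R|) ->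
  `|x j - (z j)%:~R| <= torus_norm x.
Proof.
by move=> xz; apply: le_trans (le_dist_int xz) _; exact: le_bigmax.
Qed.

(** Pigeonhole on the [K^d + 1] multiples [i alpha] with [0 <= i <= K^d]; [q] is the difference of
    two indices. *)
Lemma dirichlet (R : realType) (d K : nat) (alpha : 'I_d -> R) :
  (0 < K)%N ->
  exists q : nat, (0 < q <= K ^ d)%N /\
    torus_norm (fun j => q%:R * alpha j) < K%:R^-1.
Proof.
move=> K0.
have [|a [b [ab [p pP]]]] := @torus_pigeonhole R d K 'I_(K ^ d).+1
  (fun i j => i%:R * alpha j) K0; first by rewrite card_ord.
wlog lt_ba : a b ab p pP / (b < a)%N => [wl|].
  case: (ltngtP b a) => [| |/val_inj ba]; first exact: wl pP.
    apply: (wl b a _ (fun j => - p j)) => [|j]; first by rewrite eq_sym.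
    by move: (pP j); rewrite -normrN intrN; congr (`|_| < _); ring.
  by rewrite ba eqxx in ab.
exists (a - b)%N; split.
  by rewrite subn_gt0 lt_ba /=; apply: leq_trans (leq_subr _ _) _; rewrite -ltnS.
apply: (torus_norm_lt (p := p)) => [|j]; first by rewrite invr_gt0 ltr0n.
by rewrite natrB ?(ltnW lt_ba) // mulrBl.
Qed.

(** * The lattice generated by [z / N] and the integer vectors *)

Section Lattice.
Variables (R : realType) (d N : nat) (z : 'I_d -> int).
Hypothesis N0 : (0 < N)%N.

(** Letting [n] range over all integers makes sums and differences of lattice points again of this
    form; changing [n] by a multiple of [N] is absorbed by [p]. *)
Definition lattice_pt (n : int) (p : 'I_d -> int) (j : 'I_d) : R :=
  n%:~R * (z j)%:~R / N%:R + (p j)%:~R.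

Lemma lattice_separation (alpha : 'I_d -> R) (e : R) :
  0 < e ->
  (forall j, `|N%:R * alpha j - (z j)%:~R| <= e) ->
  (forall n : nat, (0 < n < N)%N -> e <= torus_norm (fun j => n%:R * alpha j)) ->
  forall (n : int) p, (0 < `|n| < N)%N -> exists j, e / 2 <= `|lattice_pt n p j|.
Proof.
move=> e0 ze best.
have NR : 0 < N%:R :> R by rewrite ltr0n.
have half (n : nat) p : (0 < n)%N -> (n.*2 <= N)%N ->
    exists j, e / 2 <= `|lattice_pt n%:Z p j|.
  move=> n0 nN; apply: contrapT => /forallNP far.
  have nltN : (0 < n < N)%N by rewrite n0 -addnn in nN *; lia.
  have := best n nltN; apply/negP; rewrite -ltNge.
  apply: (torus_norm_lt (p := fun j => - p j)) => // j.
  have nh : n%:R / N%:R <= 2^-1 :> R.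
    rewrite ler_pdivrMr // mulrC ler_pdivlMr ?ltr0n //.
    by rewrite -natrM ler_nat muln2.
  have /negP := far j; rewrite -ltNge => lt.
  have -> : n%:R * alpha j - (- p j)%:~R =
      n%:R / N%:R * (N%:R * alpha j - (z j)%:~R) + lattice_pt n%:Z p j.
    by rewrite /lattice_pt intrN -pmulrn; field; rewrite gt_eqF.
  apply: le_lt_trans (ler_normD _ _) _.
  have -> : e = 2^-1 * e + e / 2 by lra.
  apply: ler_ltD lt; rewrite normrM ler_pM // ger0_norm //.
  by rewrite divr_ge0 // ltW.
have pos (n : nat) p : (0 < n < N)%N -> exists j, e / 2 <= `|lattice_pt n%:Z p j|.
  move=> /andP[n0 nN]; have [|Nn] := leqP n.*2 N; first exact: half.
  (* Replacing [n] by [N - n] negates the point up to an integer vector, which reduces to the case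
     [n <= N / 2]. *)
  have [||j] := half (N - n)%N (fun j => - z j - p j); [by lia|by lia|].
  move=> le; exists j; rewrite -normrN; move: le; congr (_ <= `|_|).
  rewrite /lattice_pt -!pmulrn natrB ?(ltnW nN) // intrB intrN.
  by field; rewrite gt_eqF.
case=> n p hn; first exact: pos.
have [j le] := pos n.+1 (fun j => - p j) hn; exists j.
move: le; rewrite -[in X in _ -> X]normrN; congr (_ <= `|_|).
rewrite /lattice_pt NegzE !intrN; ring.
Qed.

(** If [x] were farther away, the segment from 0 to [x] would meet [m] layers of width [delta]
    around the lattice, consecutive layers being separated by gaps of width [delta]. One point in
    each layer, translated by the [N] lattice points, gives [m N > K^d] points of the torus, too
    many for the [K^d] boxes. *)
Lemma lattice_covering (K m : nat) (delta : R) :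
  (0 < K)%N -> K%:R^-1 <= delta -> (K ^ d < m * N)%N ->
  (forall (n : int) p, (0 < `|n| < N)%N -> exists j, delta <= `|lattice_pt n p j|) ->
  forall x : 'I_d -> R, (forall j, `|x j| <= 1) ->
    exists n p, forall j, `|x j - lattice_pt n p j| <= m.*2%:R * delta.
Proof.
move=> K0 Kd mNK sep x x1.
pose close (r : R) y := exists n p, forall j, `|y j - lattice_pt n p j| <= r.
have KR : 0 < K%:R :> R by rewrite ltr0n.
have delta0 : 0 < delta by apply: lt_le_trans Kd; rewrite invr_gt0.
have closeD r s y y' p n : close r y ->
    (forall j, `|y' j - y j - lattice_pt n p j| <= s) -> close (r + s) y'.
  move=> [n1 [p1 y1]] yy'; exists (n1 + n), (fun j => p1 j + p j) => j.
  have -> : y' j - lattice_pt (n1 + n) (fun j => p1 j + p j) j =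
     (y j - lattice_pt n1 p1 j) + (y' j - y j - lattice_pt n p j).
    by rewrite /lattice_pt !intrD; ring.
  by apply: le_trans (ler_normD _ _) _; rewrite lerD.
have closeW r s y : r <= s -> close r y -> close s y.
  by move=> rs [n [p yp]]; exists n, p => j; apply: le_trans rs.
apply: contrapT => xfar.
pose w (i : nat) j := i%:R / K%:R * x j.
have wS i r : close r (w i) -> close (r + delta) (w i.+1).
  move=> wi; apply: (closeD _ _ _ _ (fun=> 0) 0 wi) => j.
  have -> : w i.+1 j - w i j - lattice_pt 0 (fun=> 0) j = K%:R^-1 * x j.
    by rewrite /w /lattice_pt !mulr0z -natr1; ring.
  rewrite normrM ger0_norm ?invr_ge0 //.
  by apply: le_trans Kd; rewrite -[leRHS]mulr1 ler_wpM2l // invr_ge0.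
(* [w] steps from [0] to [x]; take the first step that leaves the neighbourhood
   of radius [2 k delta] of the lattice. *)
have layer (k : 'I_m) : exists y, close (k.*2.+1%:R * delta) y /\ ~ close (k.*2%:R * delta) y.
  have w0 : close (k.*2%:R * delta) (w 0%N).
    exists 0, (fun=> 0) => j; rewrite /w /lattice_pt !mulr0z !mul0r addr0 subr0 normr0.
    by rewrite mulr_ge0 // ltW.
  have wK : ~ close (k.*2%:R * delta) (w K).
    have -> : w K = x by apply/funext => j; rewrite /w divff ?mul1r // gt_eqF.
    move=> /closeW cl; apply: xfar; apply: cl.
    by rewrite ler_wpM2r ?(ltW delta0) // ler_nat leq_double ltnW.
  have [i [wi wSi]] : exists i, close (k.*2%:R * delta) (w i) /\
      ~ close (k.*2%:R * delta) (w i.+1).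
    apply: contrapT => /forallNP step; apply: wK.
    have : forall i, close (k.*2%:R * delta) (w i); last exact.
    elim=> // i wi; apply: contrapT => wSi.
    exact: step i (conj wi wSi).
  exists (w i.+1); split=> //.
  by rewrite -natr1 mulrDl mul1r; exact: wS.
have [y yP] := choice layer.
have [||[k n] [[k' n'] [neq [p pP]]]] := @torus_pigeonhole R d K ('I_m * 'I_N)%type
  (fun t j => y t.1 j + lattice_pt t.2%:Z (fun=> 0) j) => //.
  by rewrite card_prod !card_ord.
wlog kk' : k n k' n' p neq pP / (k <= k')%N => [wl|].
  have [|/ltnW] := leqP k k'; first exact: wl pP.
  apply: (wl _ n' _ n (fun j => - p j)); first by rewrite eq_sym.
  move=> j; move: (pP j); rewrite -normrN; congr (`|_| < _).
  by rewrite intrN; ring.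
have pP' j : `|y k' j - y k j - lattice_pt (n%:Z - n'%:Z) (fun j => - p j) j| < delta.
  apply: lt_le_trans Kd; move: (pP j); rewrite -normrN; congr (`|_| < _).
  by rewrite /lattice_pt intrB intrN /=; ring.
(* Within one layer, two translates closer than [delta] contradict [sep]. For [k < k'], [y k'] would
   be within [(2 k + 2) delta <= 2 k' delta] of the lattice, against its choice. *)
have [eqk|ltk] : (k = k') \/ (k < k')%N.
  by move: kk'; rewrite leq_eqVlt => /orP[/eqP/val_inj|]; [left|right].
  have nn' : n != n' by apply: contraNneq neq => ->; rewrite eqk.
  have [|j] := sep (n%:Z - n'%:Z) (fun j => - p j).
    move: nn'; rewrite -(inj_eq val_inj) /=.
    by have := ltn_ord n; have := ltn_ord n'; lia.
  by have := pP' j; rewrite eqk subrr sub0r normrN ltNge => /negP.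
have [ck _] := yP k; have [_ nck'] := yP k'; apply: nck'.
have := closeD _ delta _ (y k') _ _ ck (fun j => ltW (pP' j)).
apply: closeW; rewrite -[X in _ + X]mul1r -mulrDl natr1.
by rewrite ler_wpM2r ?(ltW delta0) // ler_nat; lia.
Qed.

(** Reducing [n] modulo [N] changes the point by an integer vector, and each class modulo integer
    vectors has only one representative in the half-open cube. *)
Lemma lattice_pt_frac (n : int) p (v : 'I_d -> R) :
  (forall j, 0 <= v j < 1) -> v = lattice_pt n p ->
  rank1_lattice N z v.
Proof.
move=> v01 vE; have NZ : N%:Z != 0 by lia.
exists `|(n %% N%:Z)%Z|%N.
  by have := ltz_mod n NZ; have := modz_ge0 n NZ; lia.
apply/funext => j; rewrite /Defs.frac.
set t : R := _%:R * _ / _.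
have [a tE] : exists a : int, v j = t + a%:~R.
  exists ((n %/ N%:Z)%Z * z j + p j); rewrite vE /lattice_pt {1}(divz_eq n N%:Z).
  have -> : t = (n %% N%:Z)%Z%:~R * (z j)%:~R / N%:R.
    by rewrite -[in RHS](gez0_abs (modz_ge0 n NZ)).
  rewrite !intrD !intrM -pmulrn.
  by field; rewrite gt_eqF // ltr0n.
have -> : Num.floor t = - a.
  apply: floor_def; have := v01 j; rewrite tE intrD intrN.
  by move=> /andP[? ?]; apply/andP; split; lra.
by rewrite intrN opprK.
Qed.

End Lattice.

(** * Mesh ratio *)

Lemma edist_ge (R : realType) (d : nat) (x y : pt R d) j : `|x j - y j| <= edist x y.
Proof.
rewrite -sqrtr_sqr ler_sqrt; last by apply: sumr_ge0 => i _; rewrite sqr_ge0.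
by rewrite (bigD1 j) //= lerDl sumr_ge0 // => i _; rewrite sqr_ge0.
Qed.

(** The factor [d], in place of the sharp [sqrt d], keeps the constants free of square roots. *)
Lemma edist_le (R : realType) (d : nat) (x y : pt R d) (r : R) :
  (0 < d)%N -> (forall j, `|x j - y j| <= r) -> edist x y <= d%:R * r.
Proof.
move=> d0 xyr; have r0 : 0 <= r by apply: le_trans (xyr (Ordinal d0)).
rewrite -[leRHS]ger0_norm ?mulr_ge0 // -sqrtr_sqr ler_sqrt ?sqr_ge0 //.
apply: le_trans (_ : \sum_(j < d) r ^+ 2 <= _).
  by apply: ler_sum => j _; rewrite -real_normK ?num_real // ler_pXn2r ?nnegrE.
rewrite sumr_const card_ord -[leLHS]mulr_natl exprMn ler_wpM2r ?sqr_ge0 //.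
by rewrite -natrX ler_nat -mulnn leq_pmulr.
Qed.

Lemma edist_refl (R : realType) (d : nat) (x : pt R d) : edist x x = 0.
Proof. by rewrite /edist big1 ?sqrtr0 // => j _; rewrite subrr expr0n. Qed.

(** The factor 2 undoes the half in [sep_radius]. The two distinct points make the set of distances
    nonempty, so its infimum is not the default value 0. *)
Lemma mesh_ratio_le (R : realType) (d : nat) (P : set (pt R d)) (s h : R) :
  0 < s -> (exists x y, [/\ P x, P y & x <> y]) ->
  (forall x y, P x -> P y -> x <> y -> s <= edist x y) ->
  (forall x, cube x -> exists2 y, P y & edist x y <= h) ->
  mesh_ratio P <= 2 * h / s.
Proof.
move=> s0 [x0 [y0 [Px0 Py0 xy0]]] sep cov.
have cube0 : cube ((fun=> 0) : pt R d) by move=> j; rewrite lexx ler01.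
have h0 : 0 <= h by have [y _] := cov _ cube0; apply: le_trans; exact: sqrtr_ge0.
have sepP : s / 2 <= sep_radius P.
  rewrite /sep_radius ler_wpM2r ?invr_ge0 //; apply: lb_le_inf.
    by exists (edist x0 y0), (x0, y0).
  by move=> _ [[x y] /= [Px [Py xy]] <-]; exact: sep.
have covP : cov_radius P <= h.
  apply: ge_sup; first by eexists; exists (fun=> 0); first exact: cube0.
  move=> _ [x /cov [y Py xy] <-]; apply: le_trans xy.
  apply: ge_inf; last by exists y.
  by exists 0 => _ [u _ <-]; exact: sqrtr_ge0.
have sep0 : 0 < sep_radius P by apply: lt_le_trans sepP; rewrite divr_gt0.
rewrite /mesh_ratio ler_pdivrMr //; apply: le_trans covP _.
have -> : 2 * h / s * sep_radius P = h * ((s / 2)^-1 * sep_radius P).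
  by field; rewrite gt_eqF.
by rewrite -[leLHS]mulr1 ler_wpM2l // ler_pdivlMl ?divr_gt0 // mulr1.
Qed.

(** * Rank-1 point sets of separated lattices *)

Section Rank1.
Variables (R : realType) (d N : nat) (z : 'I_d -> int) (delta : R).
Hypotheses (N0 : (0 < N)%N) (delta0 : 0 < delta).
Hypothesis sep : forall (n : int) p, (0 < `|n| < N)%N ->
  exists j, delta <= `|lattice_pt R N z n p j|.

Let point (n : nat) : pt R d := fun j => Defs.frac (n%:R * (z j)%:~R / N%:R).

Lemma rank1_point_sep n n' : (n < N)%N -> (n' < N)%N -> n <> n' ->
  delta <= edist (point n) (point n').
Proof.
move=> nN n'N nn'.
have [|j] := @sep (n%:Z - n'%:Z) (fun j =>
  Num.floor (n'%:R * (z j)%:~R / N%:R : R) - Num.floor (n%:R * (z j)%:~R / N%:R : R)).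
  by lia.
move=> le; apply: le_trans (edist_ge _ _ j); move: le; congr (_ <= `|_|).
rewrite /point /Defs.frac /lattice_pt !intrB -!pmulrn.
by set a := (Num.floor _)%:~R; set b := (Num.floor _)%:~R; ring.
Qed.

Lemma rank1_point_inj n n' : (n < N)%N -> (n' < N)%N -> point n = point n' -> n = n'.
Proof.
move=> nN n'N E; apply: contrapT => nn'.
have := rank1_point_sep nN n'N nn'; rewrite E edist_refl leNgt.
by rewrite delta0.
Qed.

(** Separation makes the [N] listed points distinct, which amounts to
    [gcd (N, z_1, ..., z_d) = 1]. *)
Lemma rank1_lattice_card : (rank1_lattice (R := R) N z #= `I_N)%card.
Proof.
have -> : rank1_lattice N z = [set point n | n in `I_N].
  apply/seteqP; split=> x [n nN]; first by move=> ->; exists n.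
  by move=> <-; exists n.
apply: inj_card_eq => n n' /set_mem nN /set_mem n'N.
exact: rank1_point_inj.
Qed.

(* Contracting the cube by [x |-> r + (1 - 3 r) x] keeps the nearby lattice
   point inside the half-open unit cube. *)
Lemma rank1_cover (r : R) : (0 < d)%N -> 0 < r ->
  (forall x : 'I_d -> R, (forall j, `|x j| <= 1) ->
     exists n p, forall j, `|x j - lattice_pt R N z n p j| <= r) ->
  forall x, cube x -> exists2 y, rank1_lattice N z y & edist x y <= d%:R * (4 * r).
Proof.
move=> d0 r0 cov x x01.
(* Once [1 <= 4 r], the origin is close enough to every point of the cube. *)
have [r4|r4] := leP 1 (4 * r).
  exists (point 0); first by exists 0%N.
  apply: edist_le => // j; apply: le_trans r4.
  have -> : point 0 j = 0 by rewrite /point /Defs.frac !mul0r floor0 subrr.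
  by have /andP[? ?] := x01 j; rewrite subr0 ger0_norm.
(* The contracted point has coordinates in [[r, 1 - 2 r]], so those of the lattice point lie in
   [[0, 1 - r]]. *)
have [|n [p np]] := cov (fun j => r + (1 - 3 * r) * x j).
  move=> j; have /andP[x0 x1] := x01 j.
  by rewrite ler_norml; apply/andP; split; nra.
exists (lattice_pt R N z n p).
  apply: (lattice_pt_frac N0 _ erefl) => j.
  have /andP[x0 x1] := x01 j; have := np j.
  by rewrite ler_norml => /andP[? ?]; apply/andP; split; nra.
apply: edist_le => // j.
have /andP[x0 x1] := x01 j; have := np j.
rewrite !ler_norml => /andP[? ?]; apply/andP; split; nra.
Qed.

Lemma rank1_mesh_ratio (K m : nat) :
  (0 < d)%N -> (1 < N)%N -> (0 < K)%N -> (0 < m)%N ->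
  K%:R^-1 <= delta -> (K ^ d < m * N)%N ->
  mesh_ratio (rank1_lattice N z) <= 16 * d%:R * m%:R :> R.
Proof.
move=> d0 N1 K0 m0 Kd mNK.
have mR : 0 < m%:R :> R by rewrite ltr0n.
have r0 : 0 < m.*2%:R * delta by rewrite mulr_gt0 // ltr0n double_gt0.
have cov := rank1_cover d0 r0 (lattice_covering N0 K0 Kd mNK sep).
have -> : 16 * d%:R * m%:R = 2 * (d%:R * (4 * (m.*2%:R * delta))) / delta.
  by rewrite -muln2 natrM; field; rewrite gt_eqF.
apply: mesh_ratio_le cov => //.
  exists (point 0), (point 1); split; [by exists 0%N|by exists 1%N|].
  by move=> /rank1_point_inj E; have := E N0 N1.
move=> _ _ [n nN ->] [n' n'N ->] nn'; apply: rank1_point_sep => // E.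
by apply: nn'; rewrite E.
Qed.

End Rank1.

(** * Best approximations *)

(** The construction compares only with the preceding term; induction extends this to all smaller
    [M], starting from [N 1 = 1], below which there is no positive [M]. *)
Lemma best_approx (R : numDomainType) (N : nat -> nat) (f : nat -> R) :
  N 1%N = 1%N ->
  (forall i, (2 <= i)%N -> f (N i) < f (N i.-1)) ->
  (forall i M, (2 <= i)%N -> (N i.-1 < M)%N -> (M < N i)%N -> f (N i.-1) <= f M) ->
  forall i M, (1 <= i)%N -> (0 < M < N i.+1)%N -> f (N i) <= f M.
Proof.
move=> N1 dec min; elim=> // i IH M _ /andP[M0 MN].
have [MNi|NiM|->] // := ltngtP M (N i.+1); last exact: (min i.+2).
case: i IH MNi {MN} => [|i] IH MNi; first by move: MNi; rewrite N1; case: M M0.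
apply: le_trans (ltW (dec i.+2 _)) (IH _ _ _) => //.
by rewrite M0.
Qed.

(** Take [K = floor (1 / e) + 1], which is at most [1 / e + 1 <= 2 / e] as [e <= 1]. *)
Lemma exists_inv_between (R : realType) (e : R) : 0 < e <= 1 ->
  exists K : nat, [/\ (0 < K)%N, K%:R^-1 <= e & K%:R <= 2 / e].
Proof.
move=> /andP[e0 e1].
have i1 : 1 <= e^-1 by rewrite -[leLHS]invr1 lef_pV2 ?posrE.
have i0 : 0 <= e^-1 by lra.
have /andP[lo hi] := truncn_itv i0.
exists (Num.truncn e^-1).+1; split=> //.
  by rewrite -[leRHS]invrK lef_pV2 ?posrE ?invr_gt0 ?ltr0n // ltW.
by rewrite -natr1; lra.
Qed.

(** * Quasi-uniformity of the family of best approximations *)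

Theorem mainTheorem6 (R : realType) (d : nat) (hd : (0 < d)%N)
  (alpha : 'I_d -> R)
  (hindep : Q_lin_indep alpha)
  (hfield : is_subfield (Qspan alpha))
  (N : nat -> nat)
  (hN1 : N 1%N = 1%N)
  (hNgt : forall i, (2 <= i)%N -> (N i.-1 < N i)%N)
  (hNdec : forall i, (2 <= i)%N ->
     torus_norm (fun j => (N i)%:R * alpha j) <
     torus_norm (fun j => (N i.-1)%:R * alpha j))
  (hNmin : forall i M, (2 <= i)%N -> (N i.-1 < M)%N -> (M < N i)%N ->
     ~ (torus_norm (fun j => M%:R * alpha j) <
        torus_norm (fun j => (N i.-1)%:R * alpha j)))
  (z : nat -> 'I_d -> int)
  (hz : forall i j (k : int),
     `|(N i)%:R * alpha j - (z i j)%:~R| <= `|(N i)%:R * alpha j - k%:~R|) :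
  exists (c C : R), 1 < c /\
    forall i, (2 <= i)%N ->
      [/\ (rank1_lattice (R:=R) (N i) (z i) #= `I_(N i))%card,
          (N i < N i.+1)%N,
          (N i.+1)%:R <= c * (N i)%:R
        & mesh_ratio (rank1_lattice (R:=R) (N i) (z i)) <= C].
Proof.
have spanM : forall x y, Qspan alpha x -> Qspan alpha y -> Qspan alpha (x * y).
  by case: hfield => _ [_ [_ [_ []]]].
have [kappa [kappa0 kP]] := simultaneous_approx_bound hd hindep spanM.
pose f n := torus_norm (fun j => n%:R * alpha j).
have best := best_approx (f := f) hN1 hNdec.
have {}best i M : (1 <= i)%N -> (0 < M < N i.+1)%N -> f (N i) <= f M.
  by apply: best => k L k2 kL Lk; rewrite leNgt; apply/negP; exact: hNmin.
(* From [kappa <= N_i e^d], any [K <= 4 / e] satisfies [K^d <= c0 N_i]. The 4 covers both uses: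
   [K <= 2 / e] for the growth of [N_i] and [K <= 2 / (e / 2)] for the mesh ratio. *)
pose c0 : R := 4 ^+ d / kappa.
have c00 : 0 < c0 by rewrite divr_gt0 // exprn_gt0.
pose m := (Num.truncn c0).+1.
have c0m : c0 < m%:R by have /andP[] := truncn_itv (ltW c00).
exists (c0 + 1), (16 * d%:R * m%:R); split; first by lra.
move=> i i2.
have Ni1 : (N i < N i.+1)%N by apply: (hNgt i.+1); lia.
have N1 k : (1 <= k)%N -> (0 < N k)%N.
  case: k => [|[|k]] // _; first by rewrite hN1.
  by have := hNgt k.+2 isT; lia.
have Ni : (1 < N i)%N.
  by have := hNgt i i2; have := N1 i.-1; lia.
have N0 : (0 < N i)%N by lia.
have NR : 0 < (N i)%:R :> R by rewrite ltr0n.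
pose e := f (N i).
(* Positivity comes from the next term, whose norm is strictly smaller. *)
have e0 : 0 < e by apply: le_lt_trans (torus_norm_ge0 _) (hNdec i.+1 (leqW i2)).
have e1 : e <= 1 by exact: torus_norm_le1.
have ze j : `|(N i)%:R * alpha j - (z i j)%:~R| <= e.
  exact: (nearest_le_torus_norm (x := fun j => (N i)%:R * alpha j)).
have kNe := kP _ _ _ N0 ze.
have powK (K : nat) : K%:R <= 4 / e -> (K ^ d)%:R <= c0 * (N i)%:R.
  move=> Ke; rewrite natrX; apply: le_trans (_ : (4 / e) ^+ d <= _).
    by rewrite ler_pXn2r ?nnegrE // divr_ge0 // ltW.
  rewrite expr_div_n /c0 mulrAC -mulrA ler_wpM2l ?exprn_ge0 //.
  by rewrite ler_pdivlMr // ler_pdivrMl ?exprn_gt0 // mulrC.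
have sep : forall (n : int) p, (0 < `|n| < N i)%N ->
    exists j, e / 2 <= `|lattice_pt R (N i) (z i) n p j|.
  apply: lattice_separation N0 _ _ e0 ze _ => n /andP[n0 nN].
  by apply: best => //; [lia|rewrite n0 (ltn_trans nN)].
have h0 : 0 < e / 2 by rewrite divr_gt0.
split=> //.
- exact: rank1_lattice_card sep.
- have [|K [K0 Ke Ke2]] := @exists_inv_between _ e; first by rewrite e0.
  (* Dirichlet's [q] approximates strictly better than [N_i], so [N_(i+1) <= q <= K^d]. *)
  have [q [/andP[q0 qK] qlt]] := dirichlet alpha K0.
  have Nq : (N i.+1 <= K ^ d)%N.
    apply: leq_trans qK; rewrite leqNgt; apply/negP => qN.
    have : f (N i) <= f q by apply: best; rewrite ?q0 // (ltnW i2).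
    by rewrite leNgt; apply/negP; rewrite negbK; exact: lt_le_trans Ke.
  apply: le_trans (_ : (K ^ d)%:R <= _); first by rewrite ler_nat.
  apply: le_trans (powK _ _) _.
    by apply: le_trans Ke2 _; rewrite ler_wpM2r ?invr_ge0 ?(ltW e0) // ler_nat.
  by rewrite ler_wpM2r ?(ltW NR) //; lra.
(* Here the separation is [delta = e / 2], and [c0 < m] gives the strict inequality
   [K^d < m N_i]. *)
- have [|K [K0 Ke Ke2]] := @exists_inv_between _ (e / 2).
    by rewrite h0 /=; lra.
  apply: (rank1_mesh_ratio N0 h0 sep hd Ni K0 _ Ke) => //.
  rewrite -(ltr_nat R) natrM; apply: le_lt_trans (powK _ _) _.
    by apply: le_trans Ke2 _; rewrite invf_div mulrA -natrM.
  by rewrite ltr_pM2r.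
Qed.
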